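(* Let $q$ be a prime power, $m,s$ positive integers, $n=ms$. Let $\alpha\in\mathbb{F}_{q^m}$ be an $\mathbb{F}_q$-normal element, $B=\{\alpha,\alpha^{q},\dots,\alpha^{q^{m-1}}\}$ the normal basis of $\mathbb{F}_{q^m}$ over $\mathbb{F}_q$ determined by $\alpha$, and $B'=\{u,u^{q},\dots,u^{q^{m-1}}\}$ the dual basis of $B$. Let $f(x)\in R_m$. Then: 1. $f(x)$ is a BPP if and only if there exists a collection $\{c_{jj}(x)=\sum_{i=0}^{s-1}c_{jji}x^i\in\mathcal{R}_{q,s}: j=1,\dots,m\}$ such that $\gcd\left(\prod_{j=1}^m c_{jj}(x),\,x^s-1\right)=1$ and $$f(x)=\sum_{1\le j\le k\le m}\ \sum_{i=0}^{s-1}\sum_{r=0}^{m-1}c_{jki}\left(\alpha^{q^j}u^{q^{k+r}}\right)x^{q^{mi+r}},$$ where the coefficients $c_{jki}$ for $j<k$ and $i\in\{0,\dots,s-1\}$ are arbitrary elements of $\mathbb{F}_q$. 2. $f(x)$ is an SBPP if and only if there exists a collection $\{c_{jj}(x)=\sum_{i=0}^{s-1}c_{jji}x^i\in\mathcal{R}_{q,s}: j=1,\dots,m\}$ such that $\prod_{j=1}^m c_{jj}(x)=1$ in $\mathcal{R}_{q,s}$ and $$f(x)=\sum_{1\le j\le k\le m}\ \sum_{i=0}^{s-1}\sum_{r=0}^{m-1}c_{jki}\left(\alpha^{q^j}u^{q^{k+r}}\right)x^{q^{mi+r}},$$ where the coefficients $c_{jki}$ for $j<k$ and $i\in\{0,\dots,s-1\}$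 are arbitrary elements of $\mathbb{F}_q$. In particular, any polynomial of the form $$f(x)=\sum_{j=1}^{m}\sum_{r=0}^{m-1}\left(\alpha^{q^j}u^{q^{j+r}}\right)x^{q^r}+\sum_{1\le j<k\le m}\ \sum_{i=0}^{s-1}\sum_{r=0}^{m-1}c_{jki}\left(\alpha^{q^j}u^{q^{k+r}}\right)x^{q^{mi+r}},$$ where the $c_{jki}$ are arbitrary elements of $\mathbb{F}_q$ for all $i\in\{0,\dots,s-1\}$, is an SBPP. 3. $f(x)$ is a DPP if and only if there exists a collection $\{c_j(x)=\sum_{i=0}^{s-1}c_{ji}x^i\in\mathcal{R}_{q,s}: j=1,\dots,m\}$ such that $\gcd\left(\prod_{j=1}^m c_j(x),\,x^s-1\right)=1$ and $$f(x)=\sum_{j=1}^m\sum_{i=0}^{s-1}\sum_{r=0}^{m-1}c_{ji}\left(\alpha^{q^j}u^{q^{j+r}}\right)x^{q^{mi+r}}.$$ 4. $f(x)$ is an SDPP if and only if there exists a collection $\{c_j(x)=\sum_{i=0}^{s-1}c_{ji}x^i\in\mathcal{R}_{q,s}: j=1,\dots,m\}$ such that $\prod_{j=1}^m c_j(x)=1$ in $\mathcal{R}_{q,s}$ and $$f(x)=\sum_{j=1}^m\sum_{i=0}^{s-1}\sum_{r=0}^{m-1}c_{ji}\left(\alpha^{q^j}u^{q^{j+r}}\right)x^{q^{mi+r}}.$$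
   Context: $\mathcal{R}_{q,s}:=\mathbb{F}_q[x]/\langle x^s-1\rangle$, and $M_m(\mathcal{R}_{q,s})$ is the algebra of $m\times m$ matrices over it. A gcd of an element of $\mathcal{R}_{q,s}$ with $x^s-1$ is computed with any polynomial representative. $R_m$ is the set of linear polynomials $\sum_{i=0}^{n-1}f_i x^{q^i}$ with all $f_i\in\mathbb{F}_{q^m}$, viewed as $\mathbb{F}_q$-linear maps $\mathbb{F}_{q^n}\to\mathbb{F}_{q^n}$ (equivalently, polynomials modulo $x^{q^n}-x$). An element $\alpha\in\mathbb{F}_{q^m}$ is $\mathbb{F}_q$-normal if $\{\alpha,\alpha^q,\dots,\alpha^{q^{m-1}}\}$ is an $\mathbb{F}_q$-basis of $\mathbb{F}_{q^m}$. The dual basis $\{u,u^q,\dots,u^{q^{m-1}}\}$ satisfies $\mathrm{Tr}_{\mathbb{F}_{q^m}/\mathbb{F}_q}(\alpha^{q^i}u^{q^j})=1$ if $i=j$ and $0$ if $i\ne j$, $0\le i,j\le m-1$. The map $\psi:M_m(\mathcal{R}_{q,s})\to R_m$: any $G\in M_m(\mathcal{R}_{q,s})$ is uniquely $G=G_0+G_1x+\cdots+G_{s-1}x^{s-1}$ with $G_i\in M_m(\mathbb{F}_q)$. For each $i$ let $g_i(x)=\sum_{r=0}^{m-1}a_{ir}x^{q^r}$, $a_{ir}\in\mathbb{F}_{q^m}$, be the unique such polynomial whose associated $\mathbb{F}_q$-linear map $\mathbb{F}_{q^m}\to\mathbb{F}_{q^m}$ has matrix $[g_i]_B=G_i$ on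 the basis $B$. Then $\psi(G):=\sum_{i=0}^{s-1}g_i(x^{q^{mi}})$. Convention for $[\cdot]_B$: rows and columns are indexed by $1,\dots,m$, with index $j$ corresponding to the basis element $\alpha^{q^j}$ (so index $m$ corresponds to $\alpha$); the $k$-th column of $[g]_B$ is the coordinate vector of $g(\alpha^{q^k})$. $GL_m(\mathcal{R}_{q,s})$ is the group of invertible matrices in $M_m(\mathcal{R}_{q,s})$; $SL_m(\mathcal{R}_{q,s})$ its subgroup of determinant-$1$ matrices; $B_m(\mathcal{R}_{q,s})$ its subgroup of invertible upper triangular matrices; $D_m(\mathcal{R}_{q,s})$ its subgroup of invertible diagonal matrices. By definition: a BPP (Borel permutation polynomial) is an element of $\psi(B_m(\mathcal{R}_{q,s}))$; an SBPP is an element of $\psi(SL_m(\mathcal{R}_{q,s})\cap B_m(\mathcal{R}_{q,s}))$; a DPP is an element of $\psi(D_m(\mathcal{R}_{q,s}))$; an SDPP is an element of $\psi(SL_m(\mathcal{R}_{q,s})\cap D_m(\mathcal{R}_{q,s}))$. ''Arbitrary'' coefficients in an equivalence means: the polynomial is of the stated type exactly when it has the displayed form for some choice of those coefficients. *)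

(* Defs.v *)
From HB Require Import structures.
From mathcomp Require Import all_boot all_order all_algebra all_fingroup all_field.
From mathcomp Require Import boolp classical_sets.

Set Implicit Arguments.
Unset Strict Implicit.
Unset Printing Implicit Defensive.

Import GRing.Theory.
Local Open Scope classical_set_scope.
Local Open Scope ring_scope.

(* R_{q,s} = F_q[x] / (x^s - 1), for F = F_q.  For 0 < s the modulus is monic
   and nonconstant, so the library's fallback quotient by 'X is not used. *)
Notation circ F s := {poly %/ ('X^s - 1 : {poly F})}.

Section Circulant.
Variables (F : finFieldType) (s : nat).

Definition circ_of (c : 'I_s -> F) : circ F s :=
  in_qpoly ('X^s - 1) (\sum_(i < s) c i *: 'X^i).

Section Groups.
Variable m : nat.

Definition GLm : set 'M[circ F s]_m := [set G | G \in unitmx].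
Definition SLm : set 'M[circ F s]_m := [set G | GLm G /\ \det G = 1].
(* [is_trig_mx] means lower triangular. *)
Definition Bm : set 'M[circ F s]_m := [set G | GLm G /\ is_trig_mx G^T].
Definition Dm : set 'M[circ F s]_m := [set G | GLm G /\ is_diag_mx G].

(* The matrix G_i over F_q in G = G_0 + G_1 x + ... + G_{s-1} x^{s-1}. *)
Definition coef_mx (G : 'M[circ F s]_m) (i : nat) : 'M[F]_m :=
  \matrix_(j, k) (G j k : {poly F})`_i.

End Groups.
End Circulant.

(* L is the field F_{q^n} and its subfield K is F_{q^m}. *)
Section Psi.
Variables (F : finFieldType) (L : splittingFieldType F).
Variables (q : nat) (K : {subfield L}).

(* Polynomials \sum_(i < n) a_i x^{q^i} with coefficients in K.  Having degree
   less than q^n, they are the reduced representatives modulo x^{q^n} - x. *)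
Definition linpoly (n : nat) : set {poly L} :=
  [set f | exists2 a : 'I_n -> L, (forall i, a i \in K)
         & f = \sum_(i < n) a i *: 'X^(q ^ i)].

Section Matrices.
Variables (m : nat) (alpha : L).

Definition is_normal : bool :=
  (alpha \in K) && basis_of K [tuple alpha ^+ (q ^ i) | i < m].

Definition is_dual (u : L) : Prop :=
  u \in K /\ forall i j : 'I_m,
    galTrace 1%AS K (alpha ^+ (q ^ i) * u ^+ (q ^ j)) = (i == j)%:R.

(* Positions 1, ..., m carry alpha^q, ..., alpha^{q^m} = alpha; since ordinals
   start at 0, i : 'I_m stands for position i.+1. *)
Definition nbasis : m.-tuple L := [tuple alpha ^+ (q ^ i.+1) | i < m].

(* [g]_B: column k holds the coordinates of the image of the k-th vector. *)
Definition mx_of (g : {poly L}) : 'M[F]_m :=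
  \matrix_(j, k) coord nbasis j g.[tnth nbasis k].

(* The unique g = \sum_(r < m) a_r x^{q^r}, a_r in K, such that [g]_B = M
   (the default 0 is only used if there is none). *)
Definition linpoly_of_mx (M : 'M[F]_m) : {poly L} :=
  xget 0 [set g | linpoly m g /\ mx_of g = M].

Definition psi (s : nat) (G : 'M[circ F s]_m) : {poly L} :=
  \sum_(i < s) (linpoly_of_mx (coef_mx G i) \Po 'X^(q ^ (m * i))).

Variable s : nat.

Definition BPP : set {poly L} := @psi s @` @Bm F s m.
Definition SBPP : set {poly L} := @psi s @` (@SLm F s m `&` @Bm F s m).
Definition DPP : set {poly L} := @psi s @` @Dm F s m.
Definition SDPP : set {poly L} := @psi s @` (@SLm F s m `&` @Dm F s m).

End Matrices.
End Psi.

(* Main.v *)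
Require Import Defs.
From HB Require Import structures.
From mathcomp Require Import all_boot all_order all_algebra all_fingroup all_field.
From mathcomp Require Import boolp classical_sets.

Set Implicit Arguments.
Unset Strict Implicit.
Unset Printing Implicit Defensive.

Import GRing.Theory.
Local Open Scope ring_scope.

(** Write alpha_j = alpha^(q^j), with 1 <= j <= m.  Everything rests on
an explicit formula for the linear polynomial of a matrix M over F:

  \sum_(j, k, r) M_jk alpha_j u^(q^(k+r)) x^(q^r).

At alpha_l the inner sum over r of u^(q^(k+r)) alpha_l^(q^r) is the sum of the
Frobenius conjugates of an element of K, that is, its trace over F, hence 1 if
k = l and 0 otherwise; so alpha_l goes to \sum_j M_jl alpha_j, as required
([linpoly_of_mxE]).  The formula gives the polynomial of M only because a linear
polynomial is determined by its values on the basis.  This also comes from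
duality: the trace relations say that the square matrices of conjugates of u and
of alpha satisfy U A = 1, so A U = 1 as well ([dual_orthogonal_col]), and these
relations recover each coefficient from the values ([linpoly_eq_on_nbasis]).

Applying the formula to each coefficient matrix of G and substituting
x^(q^(mi)) shows that psi G is the sum over all positions (j, k) of a term that
depends only on the entry G j k and vanishes with it ([psiE]).  For triangular
or diagonal G only the positions of the displayed sums remain.  Entries are
exchanged for their coefficient families by [circ_of], which is a bijection.
Finally the determinant of such a G is the product of its diagonal entries, and
an element of F[x]/(x^s - 1) is a unit exactly when it is coprime to x^s - 1,
which turns the group conditions into the stated conditions on that product. *)

(** * The ring F[x]/(x^s - 1) *)

Section CirculantRing.
Variables (F : finFieldType) (s : nat).
Hypothesis s_gt0 : (0 < s)%N.

Lemma mk_monic_circ : mk_monic ('X^s - 1 : {poly F}) = 'X^s - 1.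
Proof.
by rewrite /mk_monic -polyC1 size_XnsubC // ltnS s_gt0 monicXnsubC.
Qed.

Lemma size_mk_monic_circ : size (mk_monic ('X^s - 1 : {poly F})) = s.+1.
Proof. by rewrite mk_monic_circ -polyC1 size_XnsubC. Qed.

(** The sum has degree less than s, so reduction modulo X^s - 1 leaves it
unchanged. *)
Lemma circ_of_val (c : 'I_s -> F) :
  circ_of c = \sum_(i < s) c i *: 'X^i :> {poly F}.
Proof.
apply: in_qpoly_small; rewrite size_mk_monic_circ ltnS.
apply: (leq_trans (size_sum _ _ _)); apply/bigmax_leqP => i _.
by rewrite (leq_trans (size_scale_leq _ _)) // size_polyXn.
Qed.

Lemma coef_circ_of (c : 'I_s -> F) (i : 'I_s) : (circ_of c : {poly F})`_i = c i.
Proof.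
rewrite circ_of_val coef_sum (bigD1 i) //= coefZ coefXn eqxx mulr1.
rewrite big1 ?addr0 // => j ne_ji.
by rewrite coefZ coefXn eq_sym val_eqE (negPf ne_ji) mulr0.
Qed.

Definition circ_coef (x : circ F s) (i : 'I_s) : F := (x : {poly F})`_i.

Lemma circ_coefK (x : circ F s) : circ_of (circ_coef x) = x.
Proof.
have size_x : (size (x : {poly F}) <= s)%N.
  by rewrite -ltnS -size_mk_monic_circ; apply: size_mk_monic.
apply: val_inj; rewrite [LHS]circ_of_val.
apply/polyP => i; have [lt_is|le_si] := ltnP i s.
  by rewrite -circ_of_val (coef_circ_of _ (Ordinal lt_is)).
rewrite [RHS]nth_default ?(leq_trans size_x) // coef_sum big1 // => j _.
by rewrite coefZ coefXn gtn_eqF ?mulr0 // (leq_trans (ltn_ord j)).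
Qed.

Lemma circ_of_delta (i0 : 'I_s) : i0 = 0%N :> nat ->
  circ_of (fun i => (i == i0)%:R : F) = 1.
Proof.
move=> i00; rewrite /circ_of (bigD1 i0) //= eqxx scale1r i00 expr0.
rewrite big1 ?addr0 ?in_qpoly1 // => i /negPf->; exact: scale0r.
Qed.

(** Units are defined by coprimality with [mk_monic ('X^s - 1)]; that modulus
also occurs in the type of x, so it can only be replaced outside of x. *)
Lemma circ_unit (x : circ F s) :
  (x \is a GRing.unit) = coprimep x ('X^s - 1 : {poly F}).
Proof.
rewrite coprimep_sym.
exact: (congr1 (fun p => coprimep p (x : {poly F})) mk_monic_circ).
Qed.

End CirculantRing.

(** * Triangular and diagonal matrices *)

Section Groups.
Variables (F : finFieldType) (s m : nat).
Hypothesis s_gt0 : (0 < s)%N.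
Implicit Type G : 'M[circ F s]_m.

Lemma det_triangular G : is_trig_mx G^T -> \det G = \prod_(j < m) G j j.
Proof.
by move=> trigG; rewrite -det_tr det_trig //; apply: eq_bigr => j _; rewrite mxE.
Qed.

Lemma det_diagonal G : is_diag_mx G -> \det G = \prod_(j < m) G j j.
Proof. by move/is_diag_mx_is_trig/det_trig. Qed.

Lemma BmE G : Bm G <->
  is_trig_mx G^T /\ coprimep (\prod_(j < m) G j j : circ F s) ('X^s - 1).
Proof.
rewrite /Bm /GLm /= unitmxE circ_unit //.
by split=> [[cop trigG] | [trigG cop]]; rewrite ?det_triangular // in cop *.
Qed.

Lemma SLm_BmE G : (@SLm F s m `&` @Bm F s m)%classic G <->
  is_trig_mx G^T /\ \prod_(j < m) G j j = 1.
Proof.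
split=> [[[_ detG] [_ trigG]] | [trigG detG]].
  by rewrite -det_triangular.
have uG : G \in unitmx by rewrite unitmxE det_triangular // detG unitr1.
by split; split=> //; rewrite det_triangular.
Qed.

Lemma DmE G : Dm G <->
  is_diag_mx G /\ coprimep (\prod_(j < m) G j j : circ F s) ('X^s - 1).
Proof.
rewrite /Dm /GLm /= unitmxE circ_unit //.
by split=> [[cop diagG] | [diagG cop]]; rewrite ?det_diagonal // in cop *.
Qed.

Lemma SLm_DmE G : (@SLm F s m `&` @Dm F s m)%classic G <->
  is_diag_mx G /\ \prod_(j < m) G j j = 1.
Proof.
split=> [[[_ detG] [_ diagG]] | [diagG detG]].
  by rewrite -det_diagonal.
have uG : G \in unitmx by rewrite unitmxE det_diagonal // detG unitr1.
by split; split=> //; rewrite det_diagonal.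
Qed.

End Groups.

(** * The trace of a finite field as a sum of Frobenius powers *)

Section FrobeniusTrace.
Variables (F : finFieldType) (L : splittingFieldType F) (K : {subfield L}).

Lemma expf_card_subfield x : x \in K -> x ^+ (#|F| ^ \dim K) = x.
Proof. by rewrite Fermat's_little_theorem => /eqP. Qed.

(** The Galois group is cyclic of order [\dim K], generated by the Frobenius map
x |-> x^|F|. *)
Lemma finField_galTrace x :
  x \in K -> galTrace 1%AS K x = \sum_(i < \dim K) x ^+ (#|F| ^ i).
Proof.
move=> Kx; have [g /eqP defG Dg] := finField_galois_generator (sub1v K).
have ordg : #[g]%g = \dim K.
  by rewrite orderE -defG -galois_dim ?finField_galois ?sub1v // dimv1 divn1.
have gX i : (g ^+ i)%g x = x ^+ (#|F| ^ i).
  elim: i => [|i IHi]; first by rewrite gal_id expr1.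
  by rewrite expgSr galM // IHi Dg ?rpredX // dimv1 expn1 -exprM expnSr.
rewrite /galTrace defG /cycle.
rewrite (eq_bigl (mem ((fun i : 'I_(\dim K) => g ^+ i)%g @: 'I_(\dim K)))).
  rewrite big_imset => [|i j _ _ /eqP]; first by apply: eq_bigr.
  by rewrite cyclic.eq_expg_ord ?ordg // => /eqP.
move=> y; apply/idP/imsetP => [/cyclePmin[i lti ->] | [i _ ->]].
  by rewrite ordg in lti; exists (Ordinal lti).
exact: mem_cycle.
Qed.

(** The exponents of Frobenius matter only modulo [\dim K], so a shift permutes
the conjugates cyclically. *)
Lemma sum_frobenius_shift x k :
  x \in K -> \sum_(r < \dim K) x ^+ (#|F| ^ (k + r))
             = \sum_(r < \dim K) x ^+ (#|F| ^ r).
Proof.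
move=> Kx; elim: k => [|k <-]; first by apply: eq_bigr => r _; rewrite add0n.
(* Adding the term of index k on the left and of index k + dim K on the right,
   which are equal, makes both sides the same sum of dim K + 1 terms. *)
apply: (addrI (x ^+ (#|F| ^ k))).
transitivity (\sum_(r < (\dim K).+1) x ^+ (#|F| ^ (k + r))).
  rewrite big_ord_recl addn0; congr (_ + _); apply: eq_bigr => r _.
  by rewrite addSnnS.
rewrite big_ord_recr /= addrC; congr (_ + _).
by rewrite addnC expnD exprM expf_card_subfield.
Qed.

End FrobeniusTrace.

(** * Linear polynomials and the dual normal basis *)

Section DualNormalBasis.
Variables (F : finFieldType) (q m : nat) (L : splittingFieldType F).
Variables (K : {subfield L}) (alpha u : L).
Hypotheses (hq : #|F| = q) (hK : \dim K = m).
Hypotheses (Kalpha : alpha \in K) (hu : is_dual q K m alpha u).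

Let Ku : u \in K := proj1 hu.

(** The sum is the trace of u^(q^k) alpha^(q^l) with its conjugates shifted by
one place, since position k carries the exponent k + 1. *)
Lemma dual_orthogonal (k l : 'I_m) :
  \sum_(r < m) u ^+ (q ^ (k.+1 + r)) * alpha ^+ (q ^ (l.+1 + r)) = (k == l)%:R.
Proof.
rewrite eq_sym -(proj2 hu l k) mulrC; set w := _ * _.
have Kw : w \in K by rewrite rpredM ?rpredX.
rewrite finField_galTrace // -(sum_frobenius_shift 1) // hK hq.
apply: eq_bigr => r _; rewrite exprMn -!exprM -!expnD.
by rewrite !addnA !addn1.
Qed.

(** Duality summed over the basis instead of over the conjugates: a one-sided
inverse of a square matrix is two-sided. *)
Lemma dual_orthogonal_col (r t : 'I_m) :
  \sum_(k < m) u ^+ (q ^ (k.+1 + r)) * alpha ^+ (q ^ (k.+1 + t)) = (r == t)%:R.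
Proof.
pose U : 'M[L]_m := \matrix_(k, r) u ^+ (q ^ (k.+1 + r)).
pose A : 'M[L]_m := \matrix_(r, l) alpha ^+ (q ^ (l.+1 + r)).
have UA : U *m A = 1%:M.
  apply/matrixP=> k l; rewrite !mxE -dual_orthogonal.
  by apply: eq_bigr => i _; rewrite !mxE.
have /matrixP/(_ t r) := mulmx1C UA; rewrite !mxE eq_sym => <-.
by apply: eq_bigr => k _; rewrite !mxE mulrC.
Qed.

Hypothesis halpha : is_normal q K m alpha.

(** The exponents run over 1, ..., m instead of 0, ..., m - 1; this is the same
family, as alpha^(q^m) = alpha. *)
Lemma nbasis_basis : basis_of K (nbasis q m alpha).
Proof.
have /andP[_ Bbasis] := halpha.
rewrite basisEdim size_tuple hK leqnn andbT -{1}(span_basis Bbasis).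
apply/span_subvP => _ /mapP[i _ ->]; apply: memv_span.
have lt_m (j : nat) (ltj : (j < m)%N) : alpha ^+ (q ^ j.+1) \in nbasis q m alpha.
  by apply/mapP; exists (Ordinal ltj); rewrite ?mem_enum.
case: i => [[|i] lti] /=; last exact/lt_m/ltnW.
rewrite -[in X in X \in _](expf_card_subfield Kalpha) hK hq expr1.
by have := lt_m m.-1; rewrite prednK //; apply.
Qed.

Lemma horner_nbasis (a : 'I_m -> L) (k : 'I_m) :
  (\sum_(r < m) a r *: 'X^(q ^ r)).[tnth (nbasis q m alpha) k]
  = \sum_(r < m) a r * alpha ^+ (q ^ (k.+1 + r)).
Proof.
rewrite tnth_mktuple horner_sum; apply: eq_bigr => r _.
by rewrite hornerZ hornerXn -exprM -expnD.
Qed.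

(** The coefficient of x^(q^t) is a combination of the values with the conjugates
of u as weights, by the relations [dual_orthogonal_col]. *)
Lemma linpoly_eq_on_nbasis (f g : {poly L}) :
  linpoly q K m f -> linpoly q K m g ->
  (forall k, f.[tnth (nbasis q m alpha) k] = g.[tnth (nbasis q m alpha) k]) ->
  f = g.
Proof.
have coef_of_values (a : 'I_m -> L) t : a t =
    \sum_(k < m) u ^+ (q ^ (k.+1 + t))
      * (\sum_(r < m) a r *: 'X^(q ^ r)).[tnth (nbasis q m alpha) k].
  under eq_bigr => k _ do rewrite horner_nbasis mulr_sumr.
  rewrite exchange_big (bigD1 t) //= [X in _ + X]big1 => [|r ne_rt].
    under eq_bigr => k _ do rewrite mulrCA.
    by rewrite -mulr_sumr dual_orthogonal_col // eqxx mulr1 addr0.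
  under eq_bigr => k _ do rewrite mulrCA.
  by rewrite -mulr_sumr dual_orthogonal_col // eq_sym (negPf ne_rt) mulr0.
move=> [a _ ->] [b _ ->] eq_ab; apply: eq_bigr => r _.
rewrite (coef_of_values a) (coef_of_values b).
by under eq_bigr => k _ do rewrite eq_ab.
Qed.

(** Coordinates in a basis characterize an element only if it lies in K; this is
where the coefficients of g being in K is essential. *)
Lemma mx_ofP (M : 'M[F]_m) (g : {poly L}) : linpoly q K m g ->
  mx_of q m alpha g = M <->
  forall l, g.[tnth (nbasis q m alpha) l] =
            \sum_(j < m) M j l *: tnth (nbasis q m alpha) j.
Proof.
move=> lin_g; split=> [<- l | horner_g].
  have Kgl : g.[tnth (nbasis q m alpha) l] \in K.
    case: lin_g => a Ka ->; rewrite horner_nbasis.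
    by apply: rpred_sum => r _; rewrite rpredM ?Ka ?rpredX.
  rewrite [LHS](coord_basis nbasis_basis Kgl).
  by apply: eq_bigr => j _; rewrite mxE -tnth_nth.
apply/matrixP => j l; rewrite mxE horner_g.
under eq_bigr => i _ do rewrite (tnth_nth 0).
by rewrite coord_sum_free // (basis_free nbasis_basis).
Qed.

(** For the matrix unit at (j, k) this is x |-> Tr(u^(q^k) x) alpha^(q^j) in
1-based positions, which sends the k-th basis vector to the j-th one and the
others to 0. *)
Lemma linpoly_of_mxE (M : 'M[F]_m) :
  linpoly_of_mx q K alpha M =
  \sum_(j < m) \sum_(k < m) \sum_(r < m)
    (M j k *: (alpha ^+ (q ^ j.+1) * u ^+ (q ^ (k.+1 + r)))) *: 'X^(q ^ r).
Proof.
set g := RHS.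
pose a r := \sum_(j < m) \sum_(k < m)
  M j k *: (alpha ^+ (q ^ j.+1) * u ^+ (q ^ (k.+1 + r))).
have gE : g = \sum_(r < m) a r *: 'X^(q ^ r).
  rewrite /g; under eq_bigr => j _ do rewrite exchange_big.
  rewrite exchange_big; apply: eq_bigr => r _; rewrite scaler_suml.
  by apply: eq_bigr => j _; rewrite scaler_suml.
have lin_g : linpoly q K m g.
  exists (fun r => a r) => // r; apply: rpred_sum => j _; apply: rpred_sum => k _.
  by rewrite rpredZ // rpredM ?rpredX.
have horner_g l : g.[tnth (nbasis q m alpha) l] =
    \sum_(j < m) M j l *: tnth (nbasis q m alpha) j.
  rewrite gE horner_nbasis; under eq_bigr => r _ do rewrite mulr_suml.
  rewrite exchange_big; apply: eq_bigr => j _ /=.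
  under eq_bigr => r _ do rewrite mulr_suml.
  rewrite exchange_big tnth_mktuple /=.
  transitivity (\sum_(k < m) (M j k *: alpha ^+ (q ^ j.+1)) * (k == l)%:R).
    apply: eq_bigr => k _; rewrite -dual_orthogonal // mulr_sumr.
    by apply: eq_bigr => r _; rewrite -!scalerAl -mulrA.
  rewrite (bigD1 l) //= eqxx mulr1 big1 ?addr0 // => k /negPf->.
  exact: mulr0.
apply: xget_unique => [|h [lin_h /(mx_ofP _ lin_h) horner_h]].
  split=> //; apply/mx_ofP => //.
by apply: linpoly_eq_on_nbasis => // l; rewrite horner_g horner_h.
Qed.

(** * The map psi entry by entry *)

Variable s : nat.

(** The image under [psi] of the matrix with the single entry x at (j, k). *)
Definition psi_entry (j k : 'I_m) (x : circ F s) : {poly L} :=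
  \sum_(i < s) \sum_(r < m)
    ((x : {poly F})`_i *: (alpha ^+ (q ^ j.+1) * u ^+ (q ^ (k.+1 + r))))
      *: 'X^(q ^ (m * i + r)).

Lemma psi_entry0 j k : psi_entry j k 0 = 0.
Proof.
by apply: big1 => i _; apply: big1 => r _; rewrite coef0 !scale0r.
Qed.

Lemma psiE (G : 'M[circ F s]_m) :
  psi q K alpha G = \sum_(j < m) \sum_(k < m) psi_entry j k (G j k).
Proof.
under [RHS]eq_bigr => j _ do rewrite exchange_big.
rewrite exchange_big; apply: eq_bigr => i _ /=.
rewrite linpoly_of_mxE raddf_sum; apply: eq_bigr => j _ /=.
rewrite raddf_sum; apply: eq_bigr => k _ /=.
rewrite raddf_sum; apply: eq_bigr => r _ /=.
by rewrite comp_polyZ comp_Xn_poly -exprM -expnD mxE.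
Qed.

Lemma psi_triangular (G : 'M[circ F s]_m) : is_trig_mx G^T ->
  psi q K alpha G = \sum_(j < m) \sum_(k < m | (j <= k)%N) psi_entry j k (G j k).
Proof.
move/is_trig_mxP => trigG; rewrite psiE; apply: eq_bigr => j _.
rewrite [RHS]big_mkcond; apply: eq_bigr => k _; case: leqP => // lt_kj.
by have := trigG k j lt_kj; rewrite mxE => ->; rewrite psi_entry0.
Qed.

Lemma psi_diagonal (G : 'M[circ F s]_m) : is_diag_mx G ->
  psi q K alpha G = \sum_(j < m) psi_entry j j (G j j).
Proof.
move/is_diag_mxP => diagG; rewrite psiE; apply: eq_bigr => j _.
rewrite (bigD1 j) //= big1 ?addr0 // => k ne_kj.
by rewrite diagG ?psi_entry0 // eq_sym.
Qed.

Hypothesis s_gt0 : (0 < s)%N.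

Lemma psi_entry_circ_of j k (c : 'I_s -> F) :
  psi_entry j k (circ_of c) =
  \sum_(i < s) \sum_(r < m)
    (c i *: (alpha ^+ (q ^ j.+1) * u ^+ (q ^ (k.+1 + r))))
      *: 'X^(q ^ (m * i + r)).
Proof.
by apply: eq_bigr => i _; apply: eq_bigr => r _; rewrite coef_circ_of.
Qed.

(** The condition P on the product of the diagonal is kept abstract to cover both
the invertible matrices and those of determinant 1. *)
Lemma triangular_image (P : circ F s -> Prop) (f : {poly L}) :
  (exists2 G : 'M[circ F s]_m,
     is_trig_mx G^T /\ P (\prod_(j < m) G j j) & psi q K alpha G = f) <->
  exists c : 'I_m -> 'I_m -> 'I_s -> F,
    P (\prod_(j < m) circ_of (c j j)) /\
    f = \sum_(j < m) \sum_(k < m | (j <= k)%N) \sum_(i < s) \sum_(r < m)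
          (c j k i *: (alpha ^+ (q ^ j.+1) * u ^+ (q ^ (k.+1 + r))))
            *: 'X^(q ^ (m * i + r)).
Proof.
split=> [[G [trigG PG] <-] | [c [Pc ->]]].
  exists (fun j k => circ_coef (G j k)); split.
    by under eq_bigr => j _ do rewrite circ_coefK //.
  exact: psi_triangular.
pose G : 'M[circ F s]_m :=
  \matrix_(j, k) if (j <= k)%N then circ_of (c j k) else 0.
have trigG : is_trig_mx G^T.
  by apply/is_trig_mxP => j k lt_jk; rewrite !mxE leqNgt lt_jk.
exists G.
  by split=> //; under eq_bigr => j _ do rewrite mxE leqnn.
rewrite psi_triangular //; apply: eq_bigr => j _; apply: eq_bigr => k le_jk.
by rewrite mxE le_jk psi_entry_circ_of.
Qed.

Lemma diagonal_image (P : circ F s -> Prop) (f : {poly L}) :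
  (exists2 G : 'M[circ F s]_m,
     is_diag_mx G /\ P (\prod_(j < m) G j j) & psi q K alpha G = f) <->
  exists c : 'I_m -> 'I_s -> F,
    P (\prod_(j < m) circ_of (c j)) /\
    f = \sum_(j < m) \sum_(i < s) \sum_(r < m)
          (c j i *: (alpha ^+ (q ^ j.+1) * u ^+ (q ^ (j.+1 + r))))
            *: 'X^(q ^ (m * i + r)).
Proof.
split=> [[G [diagG PG] <-] | [c [Pc ->]]].
  exists (fun j => circ_coef (G j j)); split.
    by under eq_bigr => j _ do rewrite circ_coefK //.
  exact: psi_diagonal.
pose G : 'M[circ F s]_m := \matrix_(j, k) if j == k then circ_of (c j) else 0.
have diagG : is_diag_mx G.
  by apply/is_diag_mxP => j k ne_jk; rewrite mxE -val_eqE (negPf ne_jk).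
exists G.
  by split=> //; under eq_bigr => j _ do rewrite mxE eqxx.
rewrite psi_diagonal //; apply: eq_bigr => j _.
by rewrite mxE eqxx psi_entry_circ_of.
Qed.

End DualNormalBasis.

(** * The four families of permutation polynomials *)

Theorem theorem9 (F : finFieldType) (q m s : nat) (hq : #|F| = q)
    (hm : (0 < m)%N) (hs : (0 < s)%N)
    (L : splittingFieldType F) (hL : \dim {:L} = (m * s)%N)
    (K : {subfield L}) (hK : \dim K = m)
    (alpha : L) (halpha : is_normal q K m alpha)
    (u : L) (hu : is_dual q K m alpha u)
    (f : {poly L}) (hf : linpoly q K (m * s) f) :
  [/\
    BPP q K m alpha s f <->
    exists c : 'I_m -> 'I_m -> 'I_s -> F,
      coprimep (\prod_(j < m) circ_of (c j j) : circ F s) ('X^s - 1) /\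
      f = \sum_(j < m) \sum_(k < m | (j <= k)%N) \sum_(i < s) \sum_(r < m)
            (c j k i *: (alpha ^+ (q ^ j.+1) * u ^+ (q ^ (k.+1 + r))))
              *: 'X^(q ^ (m * i + r)),
    (SBPP q K m alpha s f <->
     exists c : 'I_m -> 'I_m -> 'I_s -> F,
       \prod_(j < m) circ_of (c j j) = 1 /\
       f = \sum_(j < m) \sum_(k < m | (j <= k)%N) \sum_(i < s) \sum_(r < m)
             (c j k i *: (alpha ^+ (q ^ j.+1) * u ^+ (q ^ (k.+1 + r))))
               *: 'X^(q ^ (m * i + r))) /\
    (forall c : 'I_m -> 'I_m -> 'I_s -> F,
       SBPP q K m alpha s
         (\sum_(j < m) \sum_(r < m)
            (alpha ^+ (q ^ j.+1) * u ^+ (q ^ (j.+1 + r))) *: 'X^(q ^ r)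
          + \sum_(j < m) \sum_(k < m | (j < k)%N) \sum_(i < s) \sum_(r < m)
              (c j k i *: (alpha ^+ (q ^ j.+1) * u ^+ (q ^ (k.+1 + r))))
                *: 'X^(q ^ (m * i + r)))),
    DPP q K m alpha s f <->
    exists c : 'I_m -> 'I_s -> F,
      coprimep (\prod_(j < m) circ_of (c j) : circ F s) ('X^s - 1) /\
      f = \sum_(j < m) \sum_(i < s) \sum_(r < m)
            (c j i *: (alpha ^+ (q ^ j.+1) * u ^+ (q ^ (j.+1 + r))))
              *: 'X^(q ^ (m * i + r))
  & SDPP q K m alpha s f <->
    exists c : 'I_m -> 'I_s -> F,
      \prod_(j < m) circ_of (c j) = 1 /\
      f = \sum_(j < m) \sum_(i < s) \sum_(r < m)
            (c j i *: (alpha ^+ (q ^ j.+1) * u ^+ (q ^ (j.+1 + r))))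
              *: 'X^(q ^ (m * i + r))].
Proof.
have [Kalpha _] := andP halpha.
have imageE (A : set 'M[circ F s]_m) (Q : 'M[circ F s]_m -> Prop) g :
    (forall G, A G <-> Q G) ->
    ((@psi F L q K m alpha s @` A)%classic g <->
     exists2 G, Q G & psi q K alpha G = g).
  by move=> AQ; split=> -[G AG <-]; exists G => //; apply/AQ.
have SBPPE g := iff_trans (imageE _ _ g (@SLm_BmE F s m))
  (triangular_image hq hK Kalpha hu halpha hs (fun x => x = 1) g).
split.
- exact: iff_trans (imageE _ _ _ (BmE hs)) (triangular_image hq hK Kalpha hu
    halpha hs (fun x => coprimep x ('X^s - 1 : {poly F})) f).
- split=> [|c]; first exact: SBPPE.
  pose i0 : 'I_s := Ordinal hs.
  (* The particular family is the general one with all diagonal entries 1,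
     whose only nonzero coefficient is that of x^0. *)
  pose c1 j k i : F := if j == k then (i == i0)%:R else c j k i.
  have c1_diag j : circ_of (c1 j j) = 1.
    rewrite -(@circ_of_delta F s i0) //.
    by congr circ_of; apply: funext => i; rewrite /c1 eqxx.
  apply/SBPPE; exists c1; split; first by apply: big1 => j _.
  rewrite -big_split; apply: eq_bigr => j _ /=.
  rewrite [RHS](bigD1 j) //=; congr (_ + _).
    rewrite (bigD1 i0) //= [X in _ + X]big1 ?addr0 => [|i /negPf ne_i].
      by apply: eq_bigr => r _; rewrite /c1 !eqxx scale1r muln0.
    by apply: big1 => r _; rewrite /c1 eqxx ne_i !scale0r.
  apply: eq_big => [k | k /ltn_eqF lt_jk].
    by rewrite ltn_neqAle andbC eq_sym val_eqE.
  by apply: eq_bigr => i _; apply: eq_bigr => r _; rewrite /c1 -val_eqE lt_jk.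
- exact: iff_trans (imageE _ _ _ (DmE hs)) (diagonal_image hq hK Kalpha hu
    halpha hs (fun x => coprimep x ('X^s - 1 : {poly F})) f).
exact: iff_trans (imageE _ _ _ (@SLm_DmE F s m))
  (diagonal_image hq hK Kalpha hu halpha hs (fun x => x = 1) f).
Qed.
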